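(* There exists an almost atomic submonoid $M$ of the additive group $\mathbb{Q}^2$ such that its finitary power monoid $\mathcal{P}_{\mathrm{fin}}(M)$ is not quasi-atomic.
   Context: All monoids are commutative and written additively, with identity $0$. The finitary power monoid $\mathcal{P}_{\mathrm{fin}}(M)$ of a monoid $M$ is the monoid of all nonempty finite subsets of $M$ under $S+T := \{s+t : s \in S, t \in T\}$. For a monoid $H$: $\mathcal{U}(H)$ is the group of invertible elements. An atom is an element $a \in H \setminus \mathcal{U}(H)$ such that $a = b+c$ with $b,c \in H$ implies $b \in \mathcal{U}(H)$ or $c \in \mathcal{U}(H)$. An element is atomic if it is invertible or a finite sum of atoms. $H$ is almost atomic (resp., quasi-atomic) if for each $b \in H$ there exists an atomic element (resp., an element) $c \in H$ such that $b+c$ is atomic. *)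

(* Defs.v *)
From HB Require Import structures.
From mathcomp Require Import all_boot all_order all_algebra.
From mathcomp Require Import finmap.

Set Implicit Arguments.
Unset Strict Implicit.
Unset Printing Implicit Defensive.

Import GRing.Theory.
Local Open Scope ring_scope.

Definition invertible (H : nmodType) (a : H) : Prop := exists b : H, a + b = 0.

Definition atom (H : nmodType) (a : H) : Prop :=
  ~ invertible a /\
  (forall b c : H, a = b + c -> invertible b \/ invertible c).

(* The empty sum is 0, which is invertible, so allowing s = [::] is harmless. *)
Definition atomic (H : nmodType) (a : H) : Prop :=
  invertible a \/
  (exists s : seq H, (forall x, x \in s -> atom x) /\ a = \sum_(x <- s) x).

Definition almost_atomic (H : nmodType) : Prop :=
  forall b : H, exists c : H, atomic c /\ atomic (b + c).

Definition quasi_atomic (H : nmodType) : Prop :=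
  forall b : H, exists c : H, atomic (b + c).

Section Submonoid.

Variables (V : nmodType) (M : addrClosed V).

Record submonoid : Type :=
  Submonoid { submonoid_val : V; _ : submonoid_val \in M }.

HB.instance Definition _ := [isSub for submonoid_val].
HB.instance Definition _ := [Choice of submonoid by <:].
HB.instance Definition _ :=
  GRing.SubChoice_isSubNmodule.Build V _ submonoid (rpred0D M).

Lemma val_submonoidD (x y : submonoid) : val (x + y) = val x + val y.
Proof. by []. Qed.

Lemma val_submonoid0 : val (0 : submonoid) = 0.
Proof. by []. Qed.

End Submonoid.

Section FinitaryPowerMonoid.

Local Open Scope fset_scope.
Local Open Scope ring_scope.

Variable H : nmodType.
Implicit Types S T : {fset H}.

Record fpower : Type :=
  Fpower { fpower_val : {fset H}; _ : fpower_val != fset0 }.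

HB.instance Definition _ := [isSub for fpower_val].
HB.instance Definition _ := [Choice of fpower by <:].

Definition fset_add S T : {fset H} := [fset (s + t)%R | s in S, t in T]%fset.

Lemma fset_addP S T x :
  reflect (exists s t, [/\ s \in S, t \in T & x = s + t :> H])
          (x \in fset_add S T).
Proof.
apply: (iffP idP) => [/imfset2P[s /= sS [t /= tT ->]]|]; first by exists s, t.
by case=> s [t [sS tT ->]]; apply/imfset2P; exists s => //; exists t.
Qed.

Lemma fset_add_neq0 S T : S != fset0 -> T != fset0 -> fset_add S T != fset0.
Proof.
move=> /fset0Pn[s sS] /fset0Pn[t tT].
by apply/fset0Pn; exists (s + t); apply/fset_addP; exists s, t.
Qed.

Definition fpower_add (A B : fpower) : fpower :=
  Sub (fset_add (val A) (val B)) (fset_add_neq0 (valP A) (valP B)).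

Lemma fpower_zero_subproof : [fset (0 : H)] != fset0.
Proof. by apply/fset0Pn; exists 0; rewrite in_fset1. Qed.

Definition fpower_zero : fpower := Sub [fset (0 : H)] fpower_zero_subproof.

Lemma fpower_addA : associative fpower_add.
Proof.
move=> A B C; apply: val_inj; apply/fsetP => x.
apply/fset_addP/fset_addP => [[a [y [aA /fset_addP[b [c [bB cC ->]]] ->]]]|].
  exists (a + b), c; split=> //; last by rewrite addrA.
  by apply/fset_addP; exists a, b.
case=> y [c [/fset_addP[a [b [aA bB ->]]] cC ->]].
exists a, (b + c); split=> //; last by rewrite addrA.
by apply/fset_addP; exists b, c.
Qed.

Lemma fpower_addC : commutative fpower_add.
Proof.
move=> A B; apply: val_inj; apply/fsetP => x.
by apply/fset_addP/fset_addP => -[a [b [aA bB ->]]]; exists b, a; rewrite addrC.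
Qed.

Lemma fpower_add0 : left_id fpower_zero fpower_add.
Proof.
move=> A; apply: val_inj; apply/fsetP => x; apply/fset_addP/idP.
  by case=> a [b [/fset1P-> bA ->]]; rewrite add0r.
by move=> xA; exists 0, x; rewrite add0r in_fset1.
Qed.

HB.instance Definition _ :=
  GRing.isNmodule.Build fpower fpower_addA fpower_addC fpower_add0.

Lemma val_fpowerD (A B : fpower) :
  val (A + B) = [fset (s + t)%R | s in val A, t in val B]%fset.
Proof. by []. Qed.

Lemma val_fpower0 : val (0 : fpower) = [fset 0]%fset.
Proof. by []. Qed.

End FinitaryPowerMonoid.

(* Main.v *)
(* Let pt s = (|s|, sum of 1/p for p in s), for s a finite multiset of primes, and
   let M consist of all the pt s together with all the differences pt s - pt t of
   height (second coordinate) above 1/2. Reducing modulo each prime p shows that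
   a height at most 1/2 occurs for only one element of M. The points (1, 1/p) are
   atoms, since a decomposition would stay among the pt s, where the first
   coordinate counts primes; they generate the difference group, so M is almost
   atomic. In the power monoid, take B = {(2, 1), (3, 1)}: every B + C has two
   distinct elements of minimal height, hence so does some summand A of any
   decomposition of B + C. The minimal height of A then exceeds 1/2, so (1, 1/p)
   divides all of A for large p, and A is not an atom. *)

Require Import Defs.
From HB Require Import structures.
From mathcomp Require Import all_boot all_order all_algebra.
From mathcomp Require Import finmap.
From mathcomp Require Import boolp.
From mathcomp Require Import ring lra.

Import Order.TTheory GRing.Theory Num.Theory.
Local Open Scope ring_scope.

(** * Sums of prime reciprocals *)

Definition recip_sum (s : seq nat) : rat := \sum_(p <- s) p%:R^-1.

Definition pt (s : seq nat) : rat * rat := ((size s)%:R, recip_sum s).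

Lemma recip_sum_cons p s : recip_sum (p :: s) = p%:R^-1 + recip_sum s.
Proof. by rewrite /recip_sum big_cons. Qed.

Lemma recip_sum_ge0 s : 0 <= recip_sum s.
Proof. by apply: sumr_ge0 => p _; rewrite invr_ge0 ler0n. Qed.

Lemma pt_nil : pt [::] = 0.
Proof. by rewrite /pt /recip_sum big_nil. Qed.

Lemma pt_cat s t : pt (s ++ t) = pt s + pt t.
Proof. by rewrite /pt size_cat natrD /recip_sum big_cat. Qed.

Lemma count_recip_le p s : (count_mem p s)%:R / p%:R <= recip_sum s.
Proof.
elim: s => [|q s IHs]; first by rewrite mul0r recip_sum_ge0.
rewrite /= recip_sum_cons natrD mulrDl lerD //.
by case: eqP => [->|_]; rewrite ?mul1r // mul0r invr_ge0 ler0n.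
Qed.

(** Clearing every denominator other than [p] isolates the contribution of [p]: [R] is the product
    of the entries of [s] distinct from [p], taken with multiplicity. *)
Lemma recip_sum_modp p s : prime p -> all prime s ->
  exists R k : nat, coprime p R /\
    R%:R * recip_sum s = R%:R * ((count_mem p s)%:R / p%:R) + k%:R.
Proof.
move=> pP; elim: s => [_|q s IHs /= /andP[qP /IHs[R [k [cR eR]]]]].
  by exists 1%N, 0%N; rewrite coprimen1 /recip_sum big_nil mul0r mulr0 addr0.
rewrite recip_sum_cons; case: eqP => [->|/eqP qp].
  by exists R, k; split => //; rewrite natrD mulrDl mul1r !mulrDr eR addrA.
exists (q * R)%N, (R + q * k)%N; split.
  by rewrite coprimeMr cR prime_coprime // dvdn_prime2 // eq_sym qp.
rewrite add0n natrD !natrM mulrDr -[_ * recip_sum s]mulrA eR.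
have q0 : (q%:R : rat) != 0 by rewrite pnatr_eq0 -lt0n prime_gt0.
have p0 : (p%:R : rat) != 0 by rewrite pnatr_eq0 -lt0n prime_gt0.
by field; rewrite ?p0 ?q0.
Qed.

Lemma coprime_mul_modI p k m n : coprime p k -> (m < p)%N -> (n < p)%N ->
  (k * m = k * n %[mod p])%N -> m = n.
Proof.
move=> cpk; wlog le_mn : m n / (m <= n)%N => [W|] mp np E.
  by case/orP: (leq_total m n) => /W-> //.
move/esym/eqP: E; rewrite eqn_mod_dvd ?leq_mul2l ?le_mn ?orbT // -mulnBr.
by rewrite Gauss_dvdr // -eqn_mod_dvd // !modn_small // => /eqP.
Qed.

(** A sum below 1 contains each prime [p] fewer than [p] times, so the residue modulo [p] determines
    the multiplicity. The bound 1 is sharp: [p] copies of [1/p] add up to 1 for every [p]. *)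
Lemma recip_sum_perm s t : all prime s -> all prime t ->
  recip_sum s = recip_sum t -> recip_sum s < 1 -> perm_eq s t.
Proof.
move=> sP tP e s1; apply/allP => p; rewrite mem_cat => p_st /=.
have pP : prime p by case/orP: p_st => /(allP _)->.
have p0 : (0 : rat) < p%:R by rewrite ltr0n prime_gt0.
have small u : recip_sum u < 1 -> (count_mem p u < p)%N.
  move=> u1; rewrite -(ltr_nat rat) -[ltRHS]mul1r -ltr_pdivrMr //.
  exact: le_lt_trans (count_recip_le p u) u1.
have [R [k [cR eR]]] := recip_sum_modp p s pP sP.
have [Q [l [cQ eQ]]] := recip_sum_modp p t pP tP.
(* The common sum times [R * Q * p], expanded in two ways; modulo [p] only the multiplicities
   survive. *)
have E : (Q * k * p + R * Q * count_mem p s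
          = R * l * p + R * Q * count_mem p t)%N.
  apply/eqP; rewrite -(eqr_nat rat) !natrD !natrM.
  have -> : (k%:R : rat) = R%:R * recip_sum s - R%:R * ((count_mem p s)%:R / p%:R).
    by rewrite eR addrC addKr.
  have -> : (l%:R : rat) = Q%:R * recip_sum t - Q%:R * ((count_mem p t)%:R / p%:R).
    by rewrite eQ addrC addKr.
  by apply/eqP; rewrite e; field; rewrite lt0r_neq0.
apply/eqP/(coprime_mul_modI p (R * Q)); rewrite ?coprimeMr ?cR ?small -?e //.
by move: E => /(congr1 (modn^~ p)); rewrite !modnMDl.
Qed.

(** * The submonoid of the plane *)

Definition in_mon (v : rat * rat) : Prop :=
  (exists s, all prime s /\ v = pt s) \/
  2^-1 < v.2 /\ exists s t, [/\ all prime s, all prime t & v = pt s - pt t].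

Definition mon : {pred rat * rat} := fun v => `[< in_mon v >].

Lemma monP v : reflect (in_mon v) (v \in mon).
Proof. exact: asboolP. Qed.

Lemma mon_diff v : v \in mon ->
  exists s t, [/\ all prime s, all prime t & v = pt s - pt t].
Proof.
case/monP=> [[s [sP ->]]|[_ //]]; exists s, [::].
by split=> //; rewrite pt_nil subr0.
Qed.

Lemma mon_ge0 v : v \in mon -> 0 <= v.2.
Proof.
case/monP=> [[s [_ ->]]|[h _]]; first exact: recip_sum_ge0.
by apply: le_trans (ltW h); rewrite invr_ge0.
Qed.

Lemma mon_low v : v \in mon -> v.2 <= 2^-1 -> exists s, all prime s /\ v = pt s.
Proof. by case/monP => // -[h _]; rewrite leNgt h. Qed.

Lemma mon_high s t : all prime s -> all prime t ->
  2^-1 < (pt s - pt t).2 -> pt s - pt t \in mon.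
Proof. by move=> sP tP h; apply/monP; right; split=> //; exists s, t. Qed.

Lemma pt_mon s : all prime s -> pt s \in mon.
Proof. by move=> sP; apply/monP; left; exists s. Qed.

(** Heights are nonnegative, so a sum of height at most 1/2 has two low summands, both of the form
    [pt s]. Above 1/2 every difference is allowed. *)
Lemma mon_addr_closed : Algebra.nmod_closed mon.
Proof.
split; first by rewrite -pt_nil pt_mon.
move=> u v uM vM.
have [le|lt] := lerP (u + v).2 2^-1.
  have u0 := mon_ge0 _ uM; have v0 := mon_ge0 _ vM; rewrite /= in le.
  have [|s [sP ->]] := mon_low _ uM; first lra.
  have [|t [tP ->]] := mon_low _ vM; first lra.
  by rewrite -pt_cat pt_mon // all_cat sP.
have [s [t [sP tP eu]]] := mon_diff _ uM.
have [s' [t' [sP' tP' ev]]] := mon_diff _ vM.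
have e : u + v = pt (s ++ s') - pt (t ++ t').
  by rewrite !pt_cat eu ev opprD addrACA.
by rewrite e mon_high -?e // all_cat ?sP ?tP.
Qed.

HB.instance Definition _ := GRing.isAddClosed.Build _ mon mon_addr_closed.

Notation monT := (submonoid mon).

(** Since 1/2 is below 1, [recip_sum_perm] recovers the multiset of primes from the height, and with
    it the first coordinate. *)
Lemma mon_low_inj (x y : monT) : (val x).2 = (val y).2 -> (val x).2 <= 2^-1 -> x = y.
Proof.
move=> e le; apply: val_inj.
have [s [sP es]] := mon_low _ (valP x) le.
have [|t [tP et]] := mon_low _ (valP y); first by rewrite -e.
rewrite es et /= in e le *; rewrite /pt e (perm_size (recip_sum_perm s t _ _ _ _)) //.
by apply: le_lt_trans le _; lra.
Qed.

Lemma mon_addIr (x y z : monT) : x + z = y + z -> x = y.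
Proof.
by move=> /(congr1 val); rewrite !val_submonoidD => /addIr /val_inj.
Qed.

Definition mon_pt s (sP : all prime s) : monT := Submonoid (pt_mon s sP).

(** * Atoms and almost atomicity *)

Lemma invertible_height (x : monT) : invertible x -> (val x).2 = 0.
Proof.
case=> y /(congr1 val); rewrite val_submonoidD => /(congr1 snd) /= e.
have := mon_ge0 _ (valP x); have := mon_ge0 _ (valP y); lra.
Qed.

Lemma mon_pt_atom (x : monT) p : prime p -> val x = pt [:: p] -> atom x.
Proof.
move=> pP ex.
have h : (val x).2 = p%:R^-1 by rewrite ex /= recip_sum_cons /recip_sum big_nil addr0.
(* The threshold 1/2 is the largest prime reciprocal, so both summands of a generator are low. *)
have h2 : (p%:R^-1 : rat) <= 2^-1.
  by rewrite lef_pV2 ?posrE ?ltr0n ?prime_gt0 // ler_nat prime_gt1.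
split=> [/invertible_height|b c e].
  by rewrite h; apply/eqP; rewrite invr_eq0 pnatr_eq0 -lt0n prime_gt0.
have b0 := mon_ge0 _ (valP b); have c0 := mon_ge0 _ (valP c).
have hbc : (val b).2 + (val c).2 = p%:R^-1 by rewrite -h e.
have [|s [_ es]] := mon_low _ (valP b); first lra.
have [|t [_ et]] := mon_low _ (valP c); first lra.
have : pt [:: p] = pt (s ++ t) by rewrite pt_cat -es -et -ex e.
(* First coordinates give [size s + size t = 1], so [s] or [t] is empty. *)
move=> /(congr1 fst) /= /eqP; rewrite eqr_nat size_cat.
have inv0 (y : monT) : val y = pt [::] -> invertible y.
  by move=> ey; exists 0; apply: val_inj; rewrite addr0 ey pt_nil.
case: s es => [/inv0|a s] es; first by left.
by case: t et => [/inv0|a' t] et; [right | rewrite /= addnS].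
Qed.

Lemma atomic_pt (x : monT) s : all prime s -> val x = pt s -> atomic x.
Proof.
move=> sP ex; right; elim: s sP x ex => [_|p s IHs /= /andP[pP sP]] x ex.
  by exists [::]; split=> //; apply: val_inj; rewrite big_nil ex pt_nil.
have pP' : all prime [:: p] by rewrite /= pP.
have [l [la el]] := IHs sP (mon_pt s sP) erefl.
exists (mon_pt [:: p] pP' :: l); split.
  move=> y; rewrite inE => /predU1P[->|/la //].
  exact: (mon_pt_atom _ p).
by apply: val_inj; rewrite big_cons -el val_submonoidD [LHS]ex -pt_cat.
Qed.

Lemma mon_almost_atomic : almost_atomic monT.
Proof.
move=> b; have [s [t [sP tP e]]] := mon_diff _ (valP b).
exists (mon_pt t tP); split; first exact: (atomic_pt _ t).
by apply: (atomic_pt _ s) => //; rewrite val_submonoidD e /= subrK.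
Qed.

(** * Flat bottoms, the obstruction to atomicity in the power monoid *)

Definition flat_bottom (S : {fset monT}) : Prop :=
  exists x y, [/\ x \in S, y \in S, x <> y &
    forall z, z \in S -> (val x).2 <= (val z).2 /\ (val y).2 <= (val z).2].

(** A lowest element of [A + B] is a sum of lowest elements of [A] and [B]. Two distinct such sums
    differ in their [A]-part or in their [B]-part. *)
Lemma flat_bottomD (A B : fpower monT) :
  flat_bottom (val (A + B)) -> flat_bottom (val A) \/ flat_bottom (val B).
Proof.
case=> x [y [/fset_addP[a [b [aA bB ->]]] /fset_addP[a' [b' [aA' bB' ->]]] ne low]].
have low' z w : z \in val A -> w \in val B ->
    (val a).2 + (val b).2 <= (val z).2 + (val w).2 /\
    (val a').2 + (val b').2 <= (val z).2 + (val w).2.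
  by move=> zA wB; apply: (low (z + w)); apply/fset_addP; exists z, w.
have [eb|nb] := pselect (b = b').
  left; exists a, a'; split=> // [ea|z zA]; first by apply: ne; rewrite ea eb.
  by have := low' z b zA bB; rewrite -eb; lra.
right; exists b, b'; split=> // z zB.
by have := low' a z aA zB; have := low' a' z aA' zB; lra.
Qed.

Lemma flat_bottom_not_invertible (A : fpower monT) :
  flat_bottom (val A) -> ~ invertible A.
Proof.
case=> x [y [xA yA ne _]] [B /(congr1 val)/fsetP e].
have /fset0Pn[b bB] := valP B; apply: ne; apply: (mon_addIr _ _ b).
have in0 z : z \in val A -> z + b = 0.
  move=> zA; apply/fset1P; rewrite -[[fset 0]%fset]/(val (0 : fpower monT)) -e.
  by apply/fset_addP; exists z, b.
by rewrite !in0.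
Qed.

Lemma flat_bottom_sum (l : seq (fpower monT)) :
  flat_bottom (val (\sum_(A <- l) A)) -> exists2 A, A \in l & flat_bottom (val A).
Proof.
elim: l => [|A l IHl].
  by rewrite big_nil => -[x [y [/fset1P-> /fset1P->]]].
rewrite big_cons => /flat_bottomD[fA|/IHl[B Bl fB]].
  by exists A; rewrite ?mem_head.
by exists B; rewrite // inE Bl orbT.
Qed.

Lemma exists_prime_recip_lt (e : rat) : 0 < e -> exists2 p, prime p & p%:R^-1 < e.
Proof.
move=> e0; have [p lt pP] := prime_above (Num.bound e^-1).
exists p => //; rewrite invf_plt ?posrE ?ltr0n ?prime_gt0 //.
apply: lt_trans (archi_boundP _) _; first by rewrite invr_ge0 ltW.
by rewrite ltr_nat.
Qed.

(* Two elements of the same height lie above 1/2, so a generator of small enough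
   height can be subtracted from every element of the set. *)
Lemma flat_bottom_not_atom (A : fpower monT) : flat_bottom (val A) -> ~ atom A.
Proof.
case=> x [y [xA yA ne low]] [_ Aatom].
have hxy : (val x).2 = (val y).2.
  by apply: le_anti; rewrite (low _ yA).1 (low _ xA).2.
have hx : 2^-1 < (val x).2.
  by rewrite ltNge; apply/negP => le; apply: ne; apply: mon_low_inj.
have [|p pP lt] := exists_prime_recip_lt ((val x).2 - 2^-1); first by rewrite subr_gt0.
have pP' : all prime [:: p] by rewrite /= pP.
pose d : monT := mon_pt [:: p] pP'.
have hd : (val d).2 = p%:R^-1 by rewrite /= recip_sum_cons /recip_sum big_nil addr0.
(* The default 0 is never taken on [A]: by the choice of [p], [z - d] keeps a height above 1/2 and
   so lies in [mon]. *)
pose g (z : monT) : monT := insubd 0 (val z - val d).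
have gK z : z \in val A -> d + g z = z.
  move=> zA; apply: val_inj; rewrite val_submonoidD val_insubd.
  have [s [t [sP tP ez]]] := mon_diff _ (valP z).
  have e : val z - val d = pt s - pt (p :: t).
    by rewrite -cat1s pt_cat ez opprD addrA addrAC.
  rewrite ifT ?[_ + (_ - _)]addrC ?subrK //.
  rewrite e mon_high -?e //= ?pP //.
  have := (low _ zA).1; rewrite -hd in lt; rewrite /= in lt *; lra.
have D0 : [fset d]%fset != fset0 by apply/fset0Pn; exists d; rewrite in_fset1.
have G0 : [fset g z | z in val A]%fset != fset0.
  by apply/fset0Pn; exists (g x); apply/imfsetP; exists x.
pose D : fpower monT := Fpower D0; pose G : fpower monT := Fpower G0.
have /Aatom[] : A = D + G.
- apply: val_inj; apply/fsetP => z; apply/idP/fset_addP => [zA|].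
    exists d, (g z); split; rewrite ?in_fset1 ?gK //.
    by apply/imfsetP; exists z.
  by case=> _ [_ [/fset1P-> /imfsetP[w /= wA ->] ->]]; rewrite gK.
- case=> B /(congr1 val)/fsetP e; have /fset0Pn[b bB] := valP B.
  have /invertible_height : invertible d.
    exists b; apply/fset1P; rewrite -[[fset 0]%fset]/(val (0 : fpower monT)) -e.
    by apply/fset_addP; exists d, b; rewrite in_fset1.
  by rewrite hd; apply/eqP; rewrite invr_eq0 pnatr_eq0 -lt0n prime_gt0.
(* Subtracting [d] lowers all heights in [A] equally, so [G] inherits the flat bottom of [A]. *)
- apply: flat_bottom_not_invertible; exists (g x), (g y); split.
  + by apply/imfsetP; exists x.
  + by apply/imfsetP; exists y.
  + by move=> e; apply: ne; rewrite -(gK x xA) -(gK y yA) e.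
  move=> _ /imfsetP[z /= zA ->].
  have h w : w \in val A -> (val (g w)).2 = (val w).2 - p%:R^-1.
    move=> /gK wK; rewrite -hd; apply/eqP; rewrite eq_sym subr_eq addrC.
    by rewrite -[X in (val X).2 == _]wK.
  by rewrite !h // !lerD2r; apply: low.
Qed.

(** * A set all of whose translates have a flat bottom *)

Lemma exists_lowest (S : {fset monT}) : S != fset0 ->
  exists2 x, x \in S & forall z, z \in S -> (val x).2 <= (val z).2.
Proof.
case/fset0Pn=> x0 x0S.
case: (arg_minP (fun z : S => (val (val z)).2) (i0 := [` x0S]%fset) (P := xpredT)) => //.
move=> x _ low; exists (val x); first exact: valP.
by move=> z zS; apply: (low [` zS]%fset).
Qed.

Lemma flat_bottom_translate (B C : fpower monT) (a a' : monT) :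
  val B = [fset a; a']%fset -> a <> a' -> (val a).2 = (val a').2 ->
  flat_bottom (val (B + C)).
Proof.
move=> eB ne h; have [c cC low] := exists_lowest _ (valP C).
exists (a + c), (a' + c); split.
- by apply/fset_addP; exists a, c; rewrite eB !inE eqxx.
- by apply/fset_addP; exists a', c; rewrite eB !inE eqxx orbT.
- by move/mon_addIr.
move=> _ /fset_addP[b [z [bB zC ->]]].
rewrite !val_submonoidD /= -h; have /low lez := zC.
have -> : (val b).2 = (val a).2.
  by move: bB; rewrite eB !inE => /orP[]/eqP->.
by rewrite lerD2l.
Qed.

Theorem theorem5p5 :
  exists M : addrClosed (rat * rat)%type,
    almost_atomic (submonoid M) /\ ~ quasi_atomic (fpower (submonoid M)).
Proof.
exists (Algebra.AddClosed.clone _ mon _); split; first exact: mon_almost_atomic.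
(* Distinct points of equal height: 1/2 + 1/2 = 1/3 + 1/3 + 1/3 = 1, but the first coordinates are 2
   and 3. *)
pose a := mon_pt [:: 2; 2]%N isT; pose a' := mon_pt [:: 3; 3; 3]%N isT.
have B0 : [fset a; a']%fset != fset0 by apply/fset0Pn; exists a; rewrite !inE eqxx.
move=> /(_ (Fpower B0))[C].
have fB : flat_bottom (val (Fpower B0 + C)).
  apply: (flat_bottom_translate _ _ a a') => //.
  change (recip_sum [:: 2; 2]%N = recip_sum [:: 3; 3; 3]%N).
  by rewrite /recip_sum !big_cons big_nil.
case=> [|[l [la el]]]; first exact: flat_bottom_not_invertible.
rewrite el in fB; have [A Al fA] := flat_bottom_sum _ fB.
exact: flat_bottom_not_atom fA (la _ Al).
Qed.
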